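(* Let $(G,l,c,B)$ be an instance of (2-SPNI) where $G=(V,A)$ is a two-terminal series-parallel graph with $n=|V|$, $m=|A|$, given with its decomposition tree $T_G$, and let $L_{\max}=\max\{l^i(a): a\in A, i=1,2\}$. The dynamic programming algorithm that computes, bottom-up over $T_G$, the sets $\mathcal{L}(H,x)$ for all graphs $H$ in $T_G$ and all $x\in\{0,\dots,B\}$ via the rules below has worst-case running time $\mathcal{O}(mB^2n^2L_{\max}^2\log(BnL_{\max}))$. Rules: if $H$ is a leaf with single arc $a^*$: if $c(a^* )\leq B$ then $\mathcal{L}(H,x)=\{(l^1(a^* ),l^2(a^* ))\}$ for $x<c(a^* )$ and $\mathcal{L}(H,x)=\{(\infty,\infty)\}$ for $c(a^* )\leq x\leq B$, and if $c(a^* )>B$ then $\mathcal{L}(H,x)=\{(l^1(a^* ),l^2(a^* ))\}$ for all $x$; if $H$ is the parallel composition of $H_1,H_2$ then $\mathcal{L}(H,x)=\max\{\bigcup_{k=0}^x\mathcal{L}(H_1,k)\odot\mathcal{L}(H_2,x-k)\}$; if $H$ is the series composition of $H_1,H_2$ then $\mathcal{L}(H,x)=\max\{\bigcup_{k=0}^x\mathcal{L}(H_1,k)\oplus\mathcal{L}(H_2,x-k)\}$.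
   Context: (2-SPNI) instance $(G,l,c,B)$: directed network $G=(V,A)$ (parallel arcs allowed) with source $s$, sink $t$, lengths $l=(l^1,l^2):A\to\mathbb{N}^2$, interdiction costs $c:A\to\mathbb{N}$, budget $B\in\mathbb{N}$. Two-terminal series-parallel graphs are built from single-arc graphs $(s,t)$ by parallel composition (identify the two sources and the two sinks) and series composition (identify the sink of the first with the source of the second). A decomposition tree $T_G$ is a rooted binary tree whose nodes are subgraphs of $G$: root $G$, leaves the single-arc graphs of the arcs of $G$, each internal node the parallel or series composition of its two children. For sets $S,T\subseteq(\mathbb{N}\cup\{\infty\})^2$: $S\oplus T=\{a+b:a\in S,b\in T\}$, $S\odot T=\{(\min\{a^1,b^1\},\min\{a^2,b^2\}):a\in S,b\in T\}$, and $\max\{S\}$ is the set of elements of $S$ not Pareto-dominated by another element of $S$, where $y_1$ dominates $y_2$ iff $y_1^k\geq y_2^k$ for $k=1,2$ and $y_1\neq y_2$. *)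

(* Defs.v *)
From mathcomp Require Import all_boot.
From mathcomp Require Import classical_sets.

Set Implicit Arguments.
Unset Strict Implicit.
Unset Printing Implicit Defensive.

(** * Networks, instances and decomposition trees *)

(* Arcs form a type of their own, so parallel arcs are allowed. *)
Record network := Network {
  vertex   : finType;
  arc_of   : finType;
  arc_tail : arc_of -> vertex;
  arc_head : arc_of -> vertex;
  source   : vertex;
  sink     : vertex }.

Record instance := Instance {
  graph    : network;
  len      : arc_of graph -> nat * nat;
  int_cost : arc_of graph -> nat;
  budget   : nat }.

Definition Lmax (I : instance) : nat :=
  \max_(a : arc_of (graph I)) maxn (len a).1 (len a).2.

Record subgraph (G : network) := Subgraph {
  verts : {set vertex G};
  arcs  : {set arc_of G};
  src   : vertex G;
  snk   : vertex G }.

Definition whole (G : network) : subgraph G :=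
  Subgraph [set: vertex G]%SET [set: arc_of G]%SET (source G) (sink G).

Definition single_arc (G : network) (a : arc_of G) : subgraph G :=
  Subgraph [set arc_tail a; arc_head a]%SET [set a]%SET (arc_tail a) (arc_head a).

(* Both operands live inside the same network, so "identifying" terminals
   means that they are the same vertex; the operands share nothing else. *)
Definition parallel_composition (G : network) (H1 H2 H : subgraph G) : Prop :=
  [/\ src H1 = src H2, snk H1 = snk H2,
      verts H1 :&: verts H2 = [set src H1; snk H1]%SET,
      arcs H1 :&: arcs H2 = finset.set0 &
      H = Subgraph (verts H1 :|: verts H2) (arcs H1 :|: arcs H2)
                   (src H1) (snk H1)].

Definition series_composition (G : network) (H1 H2 H : subgraph G) : Prop :=
  [/\ snk H1 = src H2,
      verts H1 :&: verts H2 = [set snk H1]%SET,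
      arcs H1 :&: arcs H2 = finset.set0 &
      H = Subgraph (verts H1 :|: verts H2) (arcs H1 :|: arcs H2)
                   (src H1) (snk H2)].

Inductive composition := Parallel | Series.

Inductive tree (A : Type) :=
  | Leaf of A
  | Node of composition & tree A & tree A.
Arguments Leaf {A} _.
Arguments Node {A} _ _ _.

(* [tree_of T H]: T is a decomposition tree of the subgraph H. *)
Inductive tree_of (G : network) : tree (arc_of G) -> subgraph G -> Prop :=
  | TreeLeaf a :
      arc_tail a != arc_head a -> tree_of (Leaf a) (single_arc a)
  | TreeParallel T1 T2 H1 H2 H :
      tree_of T1 H1 -> tree_of T2 H2 -> parallel_composition H1 H2 H ->
      tree_of (Node Parallel T1 T2) H
  | TreeSeries T1 T2 H1 H2 H :
      tree_of T1 H1 -> tree_of T2 H2 -> series_composition H1 H2 H ->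
      tree_of (Node Series T1 T2) H.

(* The existence of such a T is what makes G two-terminal series-parallel. *)
Definition decomposition_tree (G : network) (T : tree (arc_of G)) : Prop :=
  tree_of T (whole G).

(** * The sets L(H,x) *)

(* None is infinity. *)
Definition enat := option nat.

Definition eadd (a b : enat) : enat :=
  if a is Some m then if b is Some n then Some (m + n) else None else None.

Definition emin (a b : enat) : enat :=
  if a is Some m then if b is Some n then Some (minn m n) else a else b.

Definition ele (a b : enat) : bool :=
  if b is Some n then if a is Some m then m <= n else false else true.

Definition point := (enat * enat)%type.

Definition padd (p q : point) : point := (eadd p.1 q.1, eadd p.2 q.2).
Definition pmin (p q : point) : point := (emin p.1 q.1, emin p.2 q.2).

Definition dominates (p q : point) : Prop :=
  [/\ ele q.1 p.1, ele q.2 p.2 & p <> q].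

Definition oplus (S T : set point) : set point :=
  [set padd a b | a in S & b in T]%classic.

Definition odot (S T : set point) : set point :=
  [set pmin a b | a in S & b in T]%classic.

Definition max_set (S : set point) : set point :=
  [set p | S p /\ ~ exists2 q, S q & dominates q p]%classic.

Definition length_point (I : instance) (a : arc_of (graph I)) : point :=
  (Some (len a).1, Some (len a).2).

Definition infinity_point : point := (None, None).

Fixpoint Lset (I : instance) (H : tree (arc_of (graph I))) (x : nat)
    : set point :=
  match H with
  | Leaf a =>
      if int_cost a <= budget I then
        if x < int_cost a then [set length_point a]%classic
        else [set infinity_point]%classic
      else [set length_point a]%classic
  | Node Parallel H1 H2 =>
      max_set (\bigcup_(k in `I_x.+1) odot (Lset H1 k) (Lset H2 (x - k)))%classic
  | Node Series H1 H2 =>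
      max_set (\bigcup_(k in `I_x.+1) oplus (Lset H1 k) (Lset H2 (x - k)))%classic
  end.

(** * Unit-cost running time *)

(* A timed computation is a value together with the number of elementary steps
   used to obtain it.  Every arithmetic operation or comparison on lengths,
   interdiction costs and budgets is charged one step, and so is every call of
   a recursive procedure; between two charges a program only does a bounded
   number of pattern matchings and constructor applications. *)
Definition timed (X : Type) : Type := (X * nat)%type.

Definition result (X : Type) (u : timed X) : X := u.1.
Definition time (X : Type) (u : timed X) : nat := u.2.

Definition ret (X : Type) (v : X) : timed X := (v, 0).

Definition bind (X Y : Type) (u : timed X) (f : X -> timed Y) : timed Y :=
  let: (v, t) := u in let: (w, t') := f v in (w, t + t').

Definition step (X : Type) (u : timed X) : timed X :=
  let: (v, t) := u in (v, t.+1).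

Notation "'let!' x ':=' u 'in' v" := (bind u (fun x => v))
  (at level 200, x name, u at level 100, v at level 200,
   format "'[v' 'let!'  x  ':='  u  'in' '/' v ']'").

Definition eadd_op (a b : enat) : timed enat := step (ret (eadd a b)).
Definition emin_op (a b : enat) : timed enat := step (ret (emin a b)).
Definition ele_op  (a b : enat) : timed bool := step (ret (ele a b)).
Definition leq_op  (m n : nat)  : timed bool := step (ret (m <= n)).
Definition succ_op (n : nat)    : timed nat  := step (ret n.+1).

Definition padd_op (p q : point) : timed point :=
  let! a := eadd_op p.1 q.1 in
  let! b := eadd_op p.2 q.2 in
  ret (a, b).

Definition pmin_op (p q : point) : timed point :=
  let! a := emin_op p.1 q.1 in
  let! b := emin_op p.2 q.2 in
  ret (a, b).

(** * Computing max(S): merge sort, then one sweep *)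

(* Decreasing lexicographic order. *)
Definition lex_ge (p q : point) : timed bool :=
  let! b1 := ele_op q.1 p.1 in
  if b1 then
    let! b2 := ele_op p.1 q.1 in
    if b2 then ele_op q.2 p.2 else ret true
  else ret false.

Fixpoint merge_lists (s1 : seq point) : seq point -> timed (seq point) :=
  match s1 with
  | [::] => fun s2 => step (ret s2)
  | p :: s1' =>
      fix merge_s1 (s2 : seq point) : timed (seq point) :=
        step (match s2 with
              | [::] => ret s1
              | q :: s2' =>
                  let! b := lex_ge p q in
                  if b then let! r := merge_lists s1' s2 in ret (p :: r)
                  else let! r := merge_s1 s2' in ret (q :: r)
              end)
  end.

Fixpoint singletons (s : seq point) : timed (seq (seq point)) :=
  step (match s with
        | [::] => ret [::]
        | p :: s' => let! r := singletons s' in ret ([:: p] :: r)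
        end).

Fixpoint merge_pairs (ss : seq (seq point)) : timed (seq (seq point)) :=
  step (match ss with
        | s1 :: s2 :: ss' =>
            let! s := merge_lists s1 s2 in
            let! r := merge_pairs ss' in
            ret (s :: r)
        | _ => ret ss
        end).

(* [fuel] only makes the recursion structural: any list at least as long as
   [ss] will do, so the input of the sort is passed and nothing is computed. *)
Fixpoint merge_all (fuel : seq point) (ss : seq (seq point))
    : timed (seq point) :=
  step (match ss with
        | [::] => ret [::]
        | [:: s] => ret s
        | _ => if fuel is _ :: fuel' then
                 let! ss' := merge_pairs ss in merge_all fuel' ss'
               else ret [::]
        end).

Definition merge_sort (s : seq point) : timed (seq point) :=
  let! ss := singletons s in merge_all s ss.

(* On a decreasing list, a point is kept iff its second coordinate exceeds
   [best], the largest second coordinate met so far. *)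
Fixpoint sweep (best : enat) (s : seq point) : timed (seq point) :=
  step (match s with
        | [::] => ret [::]
        | p :: s' =>
            let! b := ele_op p.2 best in
            if b then sweep best s'
            else let! r := sweep p.2 s' in ret (p :: r)
        end).

Definition max_list (s : seq point) : timed (seq point) :=
  let! s' := merge_sort s in
  if s' is p :: s'' then let! r := sweep p.2 s'' in ret (p :: r)
  else ret [::].

(** * The dynamic program *)

(* Entry x of a table is a list of the elements of L(H,x), for x = 0,...,B. *)
Definition table := seq (seq point).

Definition leaf_entry (I : instance) (a : arc_of (graph I)) (x : nat)
    : timed (seq point) :=
  let! b := leq_op (int_cost a) (budget I) in
  if b then
    let! b' := leq_op (int_cost a) x in
    ret (if b' then [:: infinity_point] else [:: length_point a])
  else ret [:: length_point a].

(* The entries x, x+1, ..., x+r-1. *)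
Fixpoint leaf_table (I : instance) (a : arc_of (graph I)) (x r : nat)
    : timed table :=
  step (if r is r'.+1 then
          let! e := leaf_entry a x in
          let! y := succ_op x in
          let! t := leaf_table a y r' in
          ret (e :: t)
        else ret [::]).

Fixpoint prod_row (op : point -> point -> timed point)
    (a : point) (s acc : seq point) : timed (seq point) :=
  step (match s with
        | [::] => ret acc
        | b :: s' => let! p := op a b in prod_row op a s' (p :: acc)
        end).

Fixpoint prod_lists (op : point -> point -> timed point)
    (s1 s2 acc : seq point) : timed (seq point) :=
  step (match s1 with
        | [::] => ret acc
        | a :: s1' =>
            let! acc' := prod_row op a s2 acc in prod_lists op s1' s2 acc'
        end).

(* With t2rev the entries x, x-1, ..., 0 of the second table, and t1 the first
   table, this lists the union over k = 0, ..., x of the products of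
   L(H1,k) and L(H2,x-k). *)
Fixpoint union_products (op : point -> point -> timed point)
    (t1 t2rev : table) (acc : seq point) : timed (seq point) :=
  step (match t1, t2rev with
        | s1 :: t1', s2 :: t2rev' =>
            let! acc' := prod_lists op s1 s2 acc in
            union_products op t1' t2rev' acc'
        | _, _ => ret acc
        end).

Fixpoint compose_from (op : point -> point -> timed point)
    (t1 t2rev t2 : table) : timed table :=
  step (match t2 with
        | [::] => ret [::]
        | s :: t2' =>
            let! U := union_products op t1 (s :: t2rev) [::] in
            let! e := max_list U in
            let! r := compose_from op t1 (s :: t2rev) t2' in
            ret (e :: r)
        end).

Definition compose_tables (op : point -> point -> timed point)
    (t1 t2 : table) : timed table :=
  compose_from op t1 [::] t2.

Inductive table_tree :=
  | TLeaf of table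
  | TNode of table & table_tree & table_tree.

Definition root_table (D : table_tree) : table :=
  match D with TLeaf t => t | TNode t _ _ => t end.

Fixpoint dynamic_program (I : instance) (H : tree (arc_of (graph I)))
    : timed table_tree :=
  step (match H with
        | Leaf a =>
            let! r := succ_op (budget I) in
            let! t := leaf_table a 0 r in
            ret (TLeaf t)
        | Node o H1 H2 =>
            let! D1 := dynamic_program H1 in
            let! D2 := dynamic_program H2 in
            let! t := compose_tables
                        (match o with Parallel => pmin_op | Series => padd_op end)
                        (root_table D1) (root_table D2) in
            ret (TNode t D1 D2)
        end).

(** * Correctness of the computed tables *)

Definition table_of (I : instance) (H : tree (arc_of (graph I))) (t : table)
    : Prop :=
  size t = (budget I).+1 /\
  forall x, x <= budget I -> [set` nth [::] t x]%classic = Lset H x.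

Fixpoint computes_all (I : instance) (H : tree (arc_of (graph I)))
    (D : table_tree) : Prop :=
  match H, D with
  | Leaf _, TLeaf t => table_of H t
  | Node _ H1 H2, TNode t D1 D2 =>
      [/\ table_of H t, computes_all H1 D1 & computes_all H2 D2]
  | _, _ => False
  end.

(* Main.v *)
From mathcomp Require Import all_boot classical_sets zify.
Require Import Defs.

(* A subgraph H has at most (|V(H)|-1) Lmax + 1 finite path lengths, and on a
   computed entry, which the sweep leaves sorted and without dominated points,
   the second coordinates are strictly increasing: the entry has at most
   W = n L + 1 points.  Each of the B+1 entries of an inner node therefore sorts
   at most (B+1) W^2 products, and as the arc sets of the leaves are pairwise
   disjoint the tree has 2m-1 nodes. *)

Set Implicit Arguments.
Unset Strict Implicit.
Unset Printing Implicit Defensive.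

(** * Values and costs of timed computations *)

Arguments bind : simpl never.
Arguments step : simpl never.
Arguments ret : simpl never.
Arguments result : simpl never.
Arguments time : simpl never.

Lemma result_bind X Y (u : timed X) (f : X -> timed Y) :
  result (bind u f) = result (f (result u)).
Proof. by rewrite /bind /result; case: u => v t /=; case: (f v). Qed.

Lemma time_bind X Y (u : timed X) (f : X -> timed Y) :
  time (bind u f) = time u + time (f (result u)).
Proof. by rewrite /bind /result /time; case: u => v t /=; case: (f v). Qed.

Lemma result_step X (u : timed X) : result (step u) = result u.
Proof. by case: u. Qed.

Lemma time_step X (u : timed X) : time (step u) = (time u).+1.
Proof. by case: u. Qed.

Lemma result_ret X (v : X) : result (ret v) = v.
Proof. by []. Qed.

Lemma time_ret X (v : X) : time (ret v) = 0.
Proof. by []. Qed.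

Definition resultE := (result_bind, result_step, result_ret).
Definition timeE := (time_bind, time_step, time_ret).

(** * The order on extended naturals and the lexicographic order on points *)

Lemma ele_refl : reflexive ele.
Proof. by case=> //= m. Qed.

Lemma ele_total : total ele.
Proof. by case=> [m|] [n|] //=; exact: leq_total. Qed.

Lemma ele_trans : transitive ele.
Proof. by case=> [m|] [n|] [p|] //=; exact: leq_trans. Qed.

Lemma ele_anti : antisymmetric ele.
Proof. by case=> [m|] [n|] //= /anti_leq->. Qed.

(** This relation is the strict order [a < b]. Second coordinates increase along it in the output of
    the sweep, and its transitivity turns that path into the absence of repetitions. *)
Lemma gt_ele_trans : transitive (fun a b : enat => ~~ ele b a).
Proof.
move=> b a c nba ncb; apply/negP => ca.
have /orP[ab|ba] := ele_total a b; last by rewrite ba in nba.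
by rewrite (ele_trans ca ab) in ncb.
Qed.

Definition lexge (p q : point) : bool := result (lex_ge p q).

Lemma lexgeE p q :
  lexge p q = ele q.1 p.1 && (ele p.1 q.1 ==> ele q.2 p.2).
Proof.
rewrite /lexge /lex_ge /ele_op !resultE; case: (ele q.1 p.1) => //=.
by rewrite !resultE; case: (ele p.1 q.1); rewrite !resultE.
Qed.

Lemma time_lex_ge p q : time (lex_ge p q) <= 3.
Proof.
rewrite /lex_ge /ele_op !timeE !resultE; case: (ele q.1 p.1) => //=.
by rewrite !timeE !resultE; case: (ele p.1 q.1); rewrite !timeE.
Qed.

Lemma lexge_total : total lexge.
Proof.
move=> p q; rewrite !lexgeE.
have := ele_total p.1 q.1; have := ele_total p.2 q.2.
by do 4![case: (ele _ _) => //=].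
Qed.

Lemma lexge_trans : transitive lexge.
Proof.
move=> q p r; rewrite !lexgeE => /andP[qp /implyP pq] /andP[rq /implyP qr].
rewrite (ele_trans rq qp) /=; apply/implyP => pr.
exact: ele_trans (qr (ele_trans qp pr)) (pq (ele_trans pr rq)).
Qed.

(** * Merge sort: correctness and running time *)

Lemma merge_lists_cons p s1 q s2 :
  merge_lists (p :: s1) (q :: s2) =
  step (let! b := lex_ge p q in
        if b then let! r := merge_lists s1 (q :: s2) in ret (p :: r)
        else let! r := merge_lists (p :: s1) s2 in ret (q :: r)).
Proof. by []. Qed.

Lemma merge_cons p s1 q s2 :
  merge lexge (p :: s1) (q :: s2) =
  if lexge p q then p :: merge lexge s1 (q :: s2)
  else q :: merge lexge (p :: s1) s2.
Proof. by []. Qed.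

Lemma merge_listsE s1 s2 : result (merge_lists s1 s2) = merge lexge s1 s2.
Proof.
elim: s1 s2 => [|p s1 IH1] s2; first by rewrite /= result_step; case: s2.
elim: s2 => [|q s2 IH2]; first by rewrite /= !resultE.
rewrite merge_lists_cons merge_cons -IH1 -IH2 result_step result_bind -/(lexge p q).
by case: (lexge p q); rewrite !resultE.
Qed.

(** Each call that compares emits one point and costs itself plus at most three coordinate
    comparisons, hence the factor 4; the final call adds 1. *)
Lemma time_merge_lists s1 s2 :
  time (merge_lists s1 s2) <= 4 * (size s1 + size s2) + 1.
Proof.
elim: s1 s2 => [|p s1 IH1] s2; first by rewrite /= !timeE; lia.
elim: s2 => [|q s2 IH2]; first by rewrite /= !timeE; lia.
rewrite merge_lists_cons time_step time_bind -/(lexge p q).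
have := time_lex_ge p q; have := IH1 (q :: s2); move: IH2.
by case: (lexge p q); rewrite !timeE /=; lia.
Qed.

Lemma result_singletons s : result (singletons s) = [seq [:: p] | p <- s].
Proof. by elim: s => //= p s IH; rewrite !resultE IH. Qed.

Lemma time_singletons s : time (singletons s) = (size s).+1.
Proof. by elim: s => //= p s IH; rewrite !timeE IH addn0. Qed.

(** Induction in steps of two, matching the recursion of [merge_pairs]. *)
Lemma seq_pair_ind A (P : seq A -> Prop) :
  P [::] -> (forall x, P [:: x]) ->
  (forall x y s, P s -> P (x :: y :: s)) -> forall s, P s.
Proof.
move=> P0 P1 P2 s; suff: P s /\ forall x, P (x :: s) by case.
by elim: s => [|x s [Ps Pxs]]; split=> // y; apply: P2.
Qed.

Lemma size_merge_pairs ss : size (result (merge_pairs ss)) = uphalf (size ss).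
Proof.
elim/seq_pair_ind: ss => [|s|s1 s2 ss IH] /=; rewrite ?resultE //=.
by rewrite IH.
Qed.

Lemma sorted_merge_pairs ss :
  all (sorted lexge) ss -> all (sorted lexge) (result (merge_pairs ss)).
Proof.
elim/seq_pair_ind: ss => [|s|s1 s2 ss IH] //=; rewrite ?resultE //=.
case/and3P=> h1 h2 /IH->; rewrite merge_listsE andbT.
exact: (merge_sorted lexge_total).
Qed.

Lemma perm_merge_pairs ss :
  perm_eq (flatten (result (merge_pairs ss))) (flatten ss).
Proof.
elim/seq_pair_ind: ss => [|s|s1 s2 ss IH] //=; rewrite ?resultE //=.
by rewrite catA perm_cat // merge_listsE perm_merge.
Qed.

Lemma time_merge_pairs ss :
  time (merge_pairs ss) <= 4 * size (flatten ss) + size ss + 1.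
Proof.
elim/seq_pair_ind: ss => [|s|s1 s2 ss IH] //=; rewrite ?timeE //=; first by lia.
rewrite !size_cat; have := time_merge_lists s1 s2; lia.
Qed.

Lemma merge_all_cons fuel s1 s2 ss :
  merge_all fuel (s1 :: s2 :: ss) =
  step (if fuel is _ :: fuel' then
          let! ss' := merge_pairs (s1 :: s2 :: ss) in merge_all fuel' ss'
        else ret [::]).
Proof. by case: fuel. Qed.

(** A round halves the number of lists, rounding up, so two or more lists lose at least one and the
    fuel cannot run out before a single list is left. *)
Lemma merge_allP fuel ss :
  all (sorted lexge) ss -> size ss <= size fuel ->
  sorted lexge (result (merge_all fuel ss)) /\
  perm_eq (result (merge_all fuel ss)) (flatten ss).
Proof.
elim: fuel ss => [|p fuel IH] [|s1 [|s2 ss]] //.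
- by move=> /= /andP[? _] _; rewrite resultE /= cats0.
- rewrite merge_all_cons result_step result_bind => srt szs.
  have [] := IH _ (sorted_merge_pairs srt).
    by rewrite size_merge_pairs; move: szs => /=; lia.
  by move=> -> h; split=> //; exact: perm_trans h (perm_merge_pairs _).
Qed.

(** At most [j] rounds take place, since each halves the bound [2 ^ j]. The total number of points
    stays constant, and [M] bounds the number of lists in every round. *)
Lemma time_merge_all fuel ss j M :
  size ss <= 2 ^ j -> size ss <= M ->
  time (merge_all fuel ss) <= j * (4 * size (flatten ss) + M + 2) + 1.
Proof.
elim: fuel ss j => [|p fuel IH] [|s1 [|s2 ss]] j; rewrite ?merge_all_cons.
- by rewrite /= !timeE; lia.
- by rewrite /= !timeE; lia.
- by rewrite /= !timeE; lia.
- by rewrite /= !timeE; lia.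
- by rewrite /= !timeE; lia.
case: j => [|j] // szj szM; rewrite time_step time_bind.
have := IH (result (merge_pairs (s1 :: s2 :: ss))) j.
rewrite size_merge_pairs (perm_size (perm_merge_pairs _)).
have := time_merge_pairs (s1 :: s2 :: ss).
move: szj; rewrite expnS; move: (2 ^ j) => e szj.
set N := size (flatten _); move: szj szM; set k := size _ => szj szM tp.
have -> : uphalf k <= e by lia.
have -> : uphalf k <= M by lia.
move=> /(_ isT isT); rewrite mulSn; lia.
Qed.

Lemma merge_sortP s :
  sorted lexge (result (merge_sort s)) /\ perm_eq (result (merge_sort s)) s.
Proof.
rewrite /merge_sort result_bind result_singletons.
have := @merge_allP s [seq [:: p] | p <- s].
rewrite flatten_map1 map_id size_map; apply=> //.
by rewrite all_map; apply/allP.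
Qed.

Lemma size_merge_sort s : size (result (merge_sort s)) = size s.
Proof. by have [_ /perm_size] := merge_sortP s. Qed.

Lemma time_merge_sort s j :
  size s <= 2 ^ j -> time (merge_sort s) <= j * (5 * size s + 2) + size s + 2.
Proof.
move=> sj; rewrite /merge_sort time_bind time_singletons result_singletons.
have := @time_merge_all s [seq [:: p] | p <- s] j (size s).
rewrite flatten_map1 map_id size_map => /(_ sj (leqnn _)); lia.
Qed.

(** * The sweep and the computation of maximal points *)

Definition undominated (s : seq point) (x : point) : Prop :=
  forall y, y \in s -> ele x.1 y.1 -> ele x.2 y.2 -> y = x.

Lemma sweep_cons best p s :
  result (sweep best (p :: s)) =
  if ele p.2 best then result (sweep best s)
  else p :: result (sweep p.2 s).
Proof.
rewrite /= result_step result_bind /ele_op result_step result_ret.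
by case: (ele p.2 best); rewrite // result_bind.
Qed.

(** The head has the largest first coordinate, so it dominates a different later point exactly when
    its second coordinate is at least as large. Conversely, a point that is at least the head in
    both coordinates must equal it. *)
Lemma undominated_cons p s x : sorted lexge (p :: s) ->
  (x \in p :: s /\ undominated (p :: s) x) <->
  x = p \/ [/\ x \in s, ~~ ele x.2 p.2 & undominated s x].
Proof.
move=> ps; have head_ge y : y \in s -> lexge p y.
  move: y; apply/allP; move: ps => /=.
  by rewrite (path_sortedE lexge_trans) => /andP[].
split=> [[]|[->|[xs xp ud]]].
- rewrite inE => /orP[/eqP->|xs] ud; first by left.
  have [->|xp] := eqVneq x p; [by left | right; split=> //].
    apply/negP => h; have /andP[x1 _] : ele x.1 p.1 && true.
      by have := head_ge _ xs; rewrite lexgeE => /andP[->].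
    by rewrite (ud p (mem_head _ _) x1 h) eqxx in xp.
  by move=> y ys; apply: ud; rewrite inE ys orbT.
- split=> [|y]; first exact: mem_head.
  rewrite inE => /orP[/eqP->//|/head_ge].
  rewrite lexgeE => /andP[yp /implyP h] py1 py2.
  have e1 := ele_anti (introT andP (conj yp py1)).
  have e2 := ele_anti (introT andP (conj (h py1) py2)).
  by rewrite (surjective_pairing y) e1 e2 -surjective_pairing.
split=> [|y]; first by rewrite inE xs orbT.
rewrite inE => /orP[/eqP->|]; last exact: ud.
by move=> _ h; rewrite h in xp.
Qed.

(** Invariant of the sweep: [best] alone summarises the points already passed, whose first
    coordinates are no smaller. A point skipped because [p.2] is at most [best] excludes nothing
    that [best] does not exclude. *)
Lemma mem_sweep best s x : sorted lexge s ->
  x \in result (sweep best s) <->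
  [/\ x \in s, ~~ ele x.2 best & undominated s x].
Proof.
elim: s best => [|p s IH] best; first by move=> _; split=> [|[]].
rewrite sweep_cons => /[dup] /path_sorted srt ps.
have cons_ud := undominated_cons x ps.
case: ifP => pb; [rewrite IH // | rewrite inE].
  split=> [[xs xb ud]|[xps xb ud]].
    have [|-> ?] := proj2 cons_ud; last by [].
    right; split=> //; apply: contra xb => xp; exact: ele_trans xp pb.
  by have [xp|[]] := proj1 cons_ud (conj xps ud); first by rewrite xp pb in xb.
split=> [h|[xps xb ud]].
  have {}h : x = p \/ [/\ x \in s, ~~ ele x.2 p.2 & undominated s x].
    by case/orP: h => [/eqP|/IH]; [left | right; auto].
  have [-> ?] := proj2 cons_ud h; split=> //.
  case: h => [->|[_ xp _]]; first by rewrite pb.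
  apply: contra xp => xb; apply: ele_trans xb _.
  by have := ele_total p.2 best; rewrite pb.
have [->|?] := proj1 cons_ud (conj xps ud); first by rewrite eqxx.
by apply/orP; right; apply/IH.
Qed.

Lemma path_sweep best s :
  path (fun a b => ~~ ele b a) best [seq p.2 | p <- result (sweep best s)].
Proof.
elim: s best => [|p s IH] best //; rewrite sweep_cons.
by case: ifP => pb //=; rewrite pb IH.
Qed.

Lemma time_sweep best s : time (sweep best s) <= 2 * size s + 1.
Proof.
elim: s best => [|p s IH] best //.
rewrite /= time_step time_bind /ele_op time_step time_ret result_step result_ret.
by case: ifP => _; rewrite ?time_bind ?time_ret;
  [have := IH best | have := IH p.2]; lia.
Qed.

Lemma max_listE s : exists2 s', sorted lexge s' /\ perm_eq s' s &
  result (max_list s) =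
  if s' is p :: s'' then p :: result (sweep p.2 s'') else [::].
Proof.
exists (result (merge_sort s)); first exact: merge_sortP.
rewrite /max_list result_bind.
by case: (result (merge_sort s)) => [|p s'']; rewrite ?result_bind.
Qed.

Lemma eq_undominated s s' x : s =i s' -> undominated s x -> undominated s' x.
Proof. by move=> e ud y; rewrite -e; exact: ud. Qed.

(** The head of the sorted list is always undominated, so it is kept outright and its second
    coordinate starts the sweep. *)
Lemma mem_max_list s x :
  x \in result (max_list s) <-> x \in s /\ undominated s x.
Proof.
have [s' [srt /perm_mem e] ->] := max_listE s.
have ud_e : undominated s x <-> undominated s' x.
  by split; apply: eq_undominated => y; rewrite e.
rewrite -e ud_e.
case: s' srt {e ud_e} => [|p s'] srt; first by split=> [|[]].
rewrite (undominated_cons x srt) -(mem_sweep p.2 x (path_sorted srt)) inE.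
by split=> [/orP[/eqP|]|[->|->]]; rewrite ?eqxx ?orbT; auto.
Qed.

(** Every kept point strictly raises [best], so second coordinates are distinct. This is what bounds
    the size of an entry. *)
Lemma uniq_max_list s : uniq [seq p.2 | p <- result (max_list s)].
Proof.
have [[|p s''] _ ->] := max_listE s; first by [].
apply: (@sorted_uniq _ (fun a b => ~~ ele b a)).
- exact: gt_ele_trans.
- by move=> a; rewrite ele_refl.
exact: path_sweep.
Qed.

Lemma time_max_list s j : size s <= 2 ^ j ->
  time (max_list s) <= j * (5 * size s + 2) + 3 * size s + 3.
Proof.
move=> sj; rewrite /max_list time_bind.
move: (time (merge_sort s)) (time_merge_sort sj) => w hw.
have sz := size_merge_sort s.
case: (result (merge_sort s)) sz => [|p s'] /= sz; first by rewrite time_ret; lia.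
rewrite time_bind time_ret; have := time_sweep p.2 s'; lia.
Qed.

(** * Products of entries and composition of tables: values and running times *)

Lemma prod_rowE op a s acc :
  result (prod_row op a s acc) = catrev [seq result (op a b) | b <- s] acc.
Proof.
by elim: s acc => [|b s IH] acc //; rewrite /= result_step result_bind IH.
Qed.

Lemma time_prod_row op a s acc c : (forall b, time (op a b) <= c) ->
  time (prod_row op a s acc) <= c.+1 * size s + 1.
Proof.
move=> opc; elim: s acc => [|b s IH] acc //; first by rewrite muln0.
rewrite /= time_step time_bind mulnS.
have := IH (result (op a b) :: acc); have := opc b; lia.
Qed.

Lemma prod_listsE op s1 s2 acc :
  result (prod_lists op s1 s2 acc) =
  catrev [seq result (op a b) | a <- s1, b <- s2] acc.
Proof.
elim: s1 acc => [|a s1 IH] acc //.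
by rewrite /= result_step result_bind IH prod_rowE catrev_catl.
Qed.

Lemma time_prod_lists op s1 s2 acc c : (forall a b, time (op a b) <= c) ->
  time (prod_lists op s1 s2 acc) <= size s1 * (c.+1 * size s2 + 2) + 1.
Proof.
move=> opc; elim: s1 acc => [|a s1 IH] acc //.
rewrite /= time_step time_bind mulSn.
have := @time_prod_row op a s2 acc c (opc a).
have := IH (result (prod_row op a s2 acc)); lia.
Qed.

(** With the second table reversed, [zip] pairs index [k] with index [x - k], so this list is the
    union over [k] before maximisation. *)
Definition products (f : point -> point -> point) (t1 t2 : table) :=
  flatten [seq [seq f a b | a <- u.1, b <- u.2] | u <- zip t1 t2].

Lemma union_productsE op t1 t2 acc :
  result (union_products op t1 t2 acc) =
  catrev (products (fun a b => result (op a b)) t1 t2) acc.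
Proof.
elim: t1 t2 acc => [|s1 t1 IH] [|s2 t2] acc //.
by rewrite /= result_step result_bind IH prod_listsE catrev_catl.
Qed.

Definition entries_le (W : nat) (t : table) : bool :=
  all (fun s : seq point => size s <= W) t.

Lemma size_products f t1 t2 W :
  entries_le W t1 -> entries_le W t2 ->
  size (products f t1 t2) <= size t2 * W ^ 2.
Proof.
elim: t1 t2 => [|s1 t1 IH] [|s2 t2] //= /andP[h1 t1W] /andP[h2 t2W].
rewrite /products /= size_cat size_allpairs mulSn leq_add ?IH //.
by rewrite -mulnn leq_mul.
Qed.

Lemma time_union_products op t1 t2 acc c W :
  (forall a b, time (op a b) <= c) ->
  entries_le W t1 -> entries_le W t2 ->
  time (union_products op t1 t2 acc) <= size t2 * (W * (c.+1 * W + 2) + 2) + 1.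
Proof.
move=> opc; elim: t1 t2 acc => [|s1 t1 IH] [|s2 t2] acc //=.
  move=> _ _; rewrite time_step time_ret; lia.
move=> /andP[h1 t1W] /andP[h2 t2W].
rewrite time_step time_bind mulSn.
have : time (prod_lists op s1 s2 acc) <= W * (c.+1 * W + 2) + 1.
  apply: leq_trans (time_prod_lists _ _ _ opc) _.
  by rewrite leq_add2r leq_mul ?leq_add2r ?leq_mul2l ?h2 ?orbT.
have : time (union_products op t1 t2 (result (prod_lists op s1 s2 acc))) <=
    size t2 * (W * (c.+1 * W + 2) + 2) + 1.
  exact: IH.
move: (W * _) (size t2 * _); lia.
Qed.

(* Below, the head of each [bind] is passed explicitly to [time_bind] and
   [result_bind]: unification would otherwise unfold the program being timed to
   find a further [bind]. *)
Lemma compose_from_cons op t1 t2rev s t2 :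
  compose_from op t1 t2rev (s :: t2) =
  step (let! U := union_products op t1 (s :: t2rev) [::] in
        let! e := max_list U in
        let! r := compose_from op t1 (s :: t2rev) t2 in
        ret (e :: r)).
Proof. by []. Qed.

Lemma size_compose_from op t1 t2rev t2 :
  size (result (compose_from op t1 t2rev t2)) = size t2.
Proof.
elim: t2 t2rev => [|s t2 IH] t2rev //.
by rewrite compose_from_cons result_step 3!result_bind /= IH.
Qed.

(** When entry [x] is reached, the traversed prefix of [t2] lies reversed on top of [t2rev]. The
    outer [rev] comes from the accumulator of [union_products]. *)
Lemma nth_compose_from op t1 t2rev t2 x : x < size t2 ->
  nth [::] (result (compose_from op t1 t2rev t2)) x =
  result (max_list (rev (products (fun a b => result (op a b)) t1
                           (rev (take x.+1 t2) ++ t2rev)))).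
Proof.
elim: t2 t2rev x => [|s t2 IH] t2rev x //.
rewrite compose_from_cons result_step 3!result_bind result_ret.
case: x => [_|x /= ltx]; first by rewrite /= union_productsE take0.
by rewrite IH // rev_cons cat_rcons.
Qed.

(** Here [b] bounds the number of paired entries, so each entry maximises at most [b * W ^ 2]
    products, sorted in at most [j] rounds. The summand 5 collects the constants 1 and 3 of the
    union and the maximisation and the call itself. *)
Lemma time_compose_from op t1 t2rev t2 c W j b :
  (forall a b, time (op a b) <= c) ->
  entries_le W t1 -> entries_le W t2rev -> entries_le W t2 ->
  size t2rev + size t2 <= b -> b * W ^ 2 <= 2 ^ j ->
  time (compose_from op t1 t2rev t2) <=
  size t2 * (b * (W * (c.+1 * W + 2) + 2) + j * (5 * (b * W ^ 2) + 2)
             + 3 * (b * W ^ 2) + 5) + 1.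
Proof.
move=> opc h1; elim: t2 t2rev => [|s t2 IH] t2rev // hr.
rewrite [entries_le _ _]/= => /andP[sW t2W] hb hj.
rewrite compose_from_cons time_step (time_bind (union_products _ _ _ _)).
rewrite (time_bind (max_list _)) (time_bind (compose_from _ _ _ _)) time_ret.
rewrite [size (s :: t2)]/= mulSn.
have hsr : entries_le W (s :: t2rev) by rewrite /= sW.
have szb : size (s :: t2rev) <= b by move: hb => /=; lia.
have := @time_union_products op t1 (s :: t2rev) [::] c W opc h1 hsr.
have := @size_products (fun a b => result (op a b)) t1 (s :: t2rev) W h1 hsr.
rewrite -size_rev -[rev _]/(catrev _ [::]) -union_productsE.
move: (result (union_products _ _ _ _)) (time (union_products _ _ _ _)) => U tU.
move=> szU htU.
have {}szU : size U <= b * W ^ 2 by rewrite (leq_trans szU) // leq_mul2r szb orbT.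
have := time_max_list (leq_trans szU hj).
move=> tm; have : time (compose_from op t1 (s :: t2rev) t2) <=
  size t2 * (b * (W * (c.+1 * W + 2) + 2) + j * (5 * (b * W ^ 2) + 2)
             + 3 * (b * W ^ 2) + 5) + 1.
  by apply: IH => //; move: hb => /=; lia.
have {}htU : tU <= b * (W * (c.+1 * W + 2) + 2) + 1.
  by rewrite (leq_trans htU) // leq_add2r leq_mul2r szb orbT.
have : j * (5 * size U + 2) <= j * (5 * (b * W ^ 2) + 2).
  by rewrite leq_mul2l leq_add2r leq_mul2l szU !orbT.
move: tm htU szU; move: (size t2 * _) => r; move: (b * (W * _ + _)) (b * W ^ 2) => u w.
move: (j * (5 * w + 2)) (j * (5 * size U + 2)); lia.
Qed.

(** * From computed lists to sets of points *)

Lemma max_set_list U :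
  [set` result (max_list U)]%classic = max_set [set` U]%classic.
Proof.
apply/seteqP; split=> p /=; rewrite mem_max_list => -[pU h]; split=> //.
  by case=> q qU [h1 h2]; apply; apply: h.
move=> q qU h1 h2; have [//|/eqP qp] := eqVneq q p.
by case: h; exists q.
Qed.

Lemma mem_products f (t1 t2 : table) x p : x < size t1 -> x < size t2 ->
  p \in products f t1 (rev (take x.+1 t2)) <->
  exists2 k, k <= x & exists a b, [/\ a \in nth [::] t1 k,
    b \in nth [::] t2 (x - k) & p = f a b].
Proof.
move=> x1 x2; have sz : size (take x.+1 t2) = x.+1 by rewrite size_takel.
have nthE k : k <= x -> nth [::] (rev (take x.+1 t2)) k = nth [::] t2 (x - k).
  by move=> kx; rewrite nth_rev ?sz ?ltnS // subSS nth_take // ltnS leq_subr.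
have szz : size (zip t1 (rev (take x.+1 t2))) = x.+1.
  by rewrite size_zip size_rev sz; apply/minn_idPr.
split=> [/flatten_mapP[u /(nthP ([::], [::]))[k]]|[k kx [a [b [ak bk ->]]]]].
  rewrite szz nth_zip_cond szz => kx; rewrite kx nthE // => <-.
  by case/allpairsP=> -[a b] [/= ak bk ->]; exists k => //; exists a, b.
apply/flatten_mapP; exists (nth [::] t1 k, nth [::] t2 (x - k)).
  apply/(nthP ([::], [::])); exists k; rewrite ?szz //.
  by rewrite nth_zip_cond szz ltnS kx nthE.
by apply/allpairsP; exists (a, b).
Qed.

(** * Bounds on finite coordinates and the number of points *)

Definition bounded (K : nat) (p : point) : Prop :=
  (forall v, p.1 = Some v -> v <= K) /\ (forall v, p.2 = Some v -> v <= K).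

Lemma bounded_pmin K p q : bounded K p -> bounded K q -> bounded K (pmin p q).
Proof.
have h a b v : (forall v, a = Some v -> v <= K) -> (forall v, b = Some v -> v <= K) ->
    emin a b = Some v -> v <= K.
  case: a b => [a|] [b|] //= ha hb; [case=> <- | exact: ha | exact: hb].
  by rewrite geq_min ha.
by move=> [p1 p2] [q1 q2]; split=> v; apply: h.
Qed.

Lemma bounded_padd K1 K2 p q :
  bounded K1 p -> bounded K2 q -> bounded (K1 + K2) (padd p q).
Proof.
have h a b v : (forall v, a = Some v -> v <= K1) ->
    (forall v, b = Some v -> v <= K2) -> eadd a b = Some v -> v <= K1 + K2.
  by case: a b => [a|] [b|] //= ha hb [<-]; rewrite leq_add ?ha ?hb.
by move=> [p1 p2] [q1 q2]; split=> v; apply: h.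
Qed.

Lemma bounded_le K K' p : K <= K' -> bounded K p -> bounded K' p.
Proof.
move=> le [h1 h2].
by split=> v e; apply: leq_trans le; [exact: h1 | exact: h2].
Qed.

(** The distinct second coordinates lie among infinity and [0, ..., K], which are [K + 2] values. *)
Lemma size_bounded K (s : seq point) : uniq [seq p.2 | p <- s] ->
  (forall p, p \in s -> bounded K p) -> size s <= K.+2.
Proof.
move=> us bs; rewrite -(size_map snd).
suff /(uniq_leq_size us) :
    {subset [seq p.2 | p <- s] <= None :: [seq Some v | v <- iota 0 K.+1]}.
  by rewrite /= size_map size_iota.
move=> v /mapP[p /bs[_ h] ->]; case: p.2 h => [w|] h; last exact: mem_head.
rewrite inE; apply/orP; right; apply/mapP.
by exists w; rewrite // mem_iota ltnS; apply: h.
Qed.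

(** * Correctness of the dynamic program *)

(** The bound for composing tables with [b] entries at two steps per product. The final 3 lets the
    same expression also cover a leaf, whose cost is at most [4 * b + 3]. *)
Definition node_cost b W j :=
  b * (b * (W * (3 * W + 2) + 2) + j * (5 * (b * W ^ 2) + 2)
       + 3 * (b * W ^ 2) + 5) + 3.

Section Instance.
Variable I : instance.
Implicit Types (a : arc_of (graph I)) (T : tree (arc_of (graph I))).

Lemma leaf_entryE a x :
  result (leaf_entry a x) =
  [:: if (int_cost a <= budget I) && (int_cost a <= x) then infinity_point
      else length_point a].
Proof.
rewrite /leaf_entry result_bind /leq_op result_step result_ret.
case: (int_cost a <= budget I) => //.
by rewrite result_bind result_step !result_ret; case: ifP.
Qed.

Lemma time_leaf_entry a x : time (leaf_entry a x) <= 2.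
Proof.
rewrite /leaf_entry time_bind /leq_op time_step result_step time_ret result_ret.
by case: (int_cost a <= budget I); rewrite // time_bind time_step !time_ret.
Qed.

Lemma leaf_table_cons a x r :
  leaf_table a x r.+1 =
  step (let! e := leaf_entry a x in
        let! y := succ_op x in
        let! t := leaf_table a y r in
        ret (e :: t)).
Proof. by []. Qed.

Lemma leaf_tableE a x r :
  result (leaf_table a x r) =
  [seq [:: if (int_cost a <= budget I) && (int_cost a <= y) then infinity_point
      else length_point a] | y <- iota x r].
Proof.
elim: r x => [|r IH] x //.
rewrite leaf_table_cons result_step (result_bind (leaf_entry _ _)) leaf_entryE.
by rewrite (result_bind (succ_op _)) (result_bind (leaf_table _ _ _)) IH.
Qed.

Lemma time_leaf_table a x r : time (leaf_table a x r) <= 4 * r + 1.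
Proof.
elim: r x => [|r IH] x //.
rewrite leaf_table_cons time_step (time_bind (leaf_entry _ _)).
rewrite (time_bind (succ_op _)) (time_bind (leaf_table _ _ _)).
rewrite (_ : time (succ_op x) = 1) // time_ret.
have := IH (result (succ_op x)); have := time_leaf_entry a x; lia.
Qed.

Lemma table_of_leaf a : table_of (Leaf a) (result (leaf_table a 0 (budget I).+1)).
Proof.
split=> [|x xB]; first by rewrite leaf_tableE size_map size_iota.
rewrite leaf_tableE (nth_map 0) ?size_iota ?ltnS // nth_iota ?ltnS // add0n.
rewrite /= (ltnNge x); case: (int_cost a <= budget I) => /=; last first.
  by apply/seteqP; split=> p /=; rewrite inE => /eqP.
by case: (int_cost a <= x); apply/seteqP; split=> p /=; rewrite inE => /eqP.
Qed.

(** Naming this choice lets series and parallel nodes share their proofs. *)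
Definition composition_op (o : composition) :=
  match o with Parallel => pmin_op | Series => padd_op end.

Lemma time_composition_op o p q : time (composition_op o p q) = 2.
Proof. by case: o. Qed.

Lemma Lset_node o T1 T2 x :
  Lset (Node o T1 T2) x =
  max_set (\bigcup_(k in `I_x.+1)
    [set result (composition_op o p q) | p in Lset T1 k & q in Lset T2 (x - k)])%classic.
Proof. by case: o. Qed.

Lemma table_of_node o T1 T2 t1 t2 : table_of T1 t1 -> table_of T2 t2 ->
  table_of (Node o T1 T2) (result (compose_tables (composition_op o) t1 t2)).
Proof.
move=> [sz1 h1] [sz2 h2]; split=> [|x xB]; first by rewrite size_compose_from.
rewrite nth_compose_from ?sz2 // cats0 max_set_list Lset_node; congr max_set.
apply/seteqP; split=> p /=; rewrite mem_rev.
  rewrite mem_products ?sz1 ?sz2 // => -[k kx [a [b [ak bk ->]]]].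
  exists k => //=; exists a; first by rewrite -h1 // (leq_trans kx).
  by exists b => //; rewrite -h2 // (leq_trans (leq_subr _ _)).
move=> [k /= kx' [a ak [b bk <-]]]; have kx : k <= x by rewrite -ltnS.
apply/mem_products; rewrite ?sz1 ?sz2 //.
exists k => //; exists a, b; split=> //.
  by move: ak; rewrite -h1 // (leq_trans kx).
by move: bk; rewrite -h2 // (leq_trans (leq_subr _ _)).
Qed.

Lemma dynamic_program_leaf a :
  dynamic_program (Leaf a) =
  step (let! r := succ_op (budget I) in
        let! t := leaf_table a 0 r in ret (TLeaf t)).
Proof. by []. Qed.

Lemma dynamic_program_node o T1 T2 :
  dynamic_program (Node o T1 T2) =
  step (let! D1 := dynamic_program T1 in
        let! D2 := dynamic_program T2 in
        let! t := compose_tables (composition_op o) (root_table D1) (root_table D2) in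
        ret (TNode t D1 D2)).
Proof. by []. Qed.

Lemma result_dp_leaf a :
  result (dynamic_program (Leaf a)) =
  TLeaf (result (leaf_table a 0 (budget I).+1)).
Proof.
rewrite dynamic_program_leaf result_step (result_bind (succ_op _)).
by rewrite (result_bind (leaf_table _ _ _)).
Qed.

Lemma result_dp_node o T1 T2 :
  result (dynamic_program (Node o T1 T2)) =
  let D1 := result (dynamic_program T1) in
  let D2 := result (dynamic_program T2) in
  TNode (result (compose_tables (composition_op o) (root_table D1) (root_table D2)))
    D1 D2.
Proof.
rewrite dynamic_program_node result_step (result_bind (dynamic_program _)).
rewrite (result_bind (dynamic_program _)).
by rewrite (result_bind (compose_tables _ _ _)).
Qed.

Lemma computes_all_root T D : computes_all T D -> table_of T (root_table D).
Proof. by case: T D => [a|o T1 T2] [t|t D1 D2] //= []. Qed.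

Lemma dynamic_program_correct T : computes_all T (result (dynamic_program T)).
Proof.
elim: T => [a|o T1 IH1 T2 IH2]; first by rewrite result_dp_leaf; exact: table_of_leaf.
rewrite result_dp_node; split=> //.
by apply: table_of_node; exact: computes_all_root.
Qed.

(** * The size of the computed entries *)

(** Leaf entries are singletons, inner entries come from [max_list], and an index beyond the table
    yields the empty default. *)
Lemma uniq_entries T x :
  uniq [seq p.2 | p <- nth [::] (root_table (result (dynamic_program T))) x].
Proof.
case: T => [a|o T1 T2].
  rewrite result_dp_leaf leaf_tableE /root_table.
  have [xs|xs] := ltnP x (budget I).+1; last by rewrite nth_default ?size_map ?size_iota.
  by rewrite (nth_map 0) ?size_iota.
rewrite result_dp_node /=.
set t := root_table _; set t' := root_table _.
have [xs|xs] := ltnP x (size t'); last by rewrite nth_default ?size_compose_from.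
by rewrite nth_compose_from // uniq_max_list.
Qed.

Lemma card_verts_gt1 T H : tree_of T H -> 1 < #|verts H|.
Proof.
elim=> [a a_neq|{}T T2 H1 H2 {}H _ IH1 _ _ [_ _ _ _ ->]
  |{}T T2 H1 H2 {}H _ IH1 _ _ [_ _ _ ->]] /=; first by rewrite cards2 a_neq.
  exact: leq_trans IH1 (subset_leq_card (finset.subsetUl _ _)).
exact: leq_trans IH1 (subset_leq_card (finset.subsetUl _ _)).
Qed.

(** The factor is the largest number of arcs on a simple path in [H]. It is 1 for a leaf, additive
    in series, and monotone in the vertex set, which suffices for minima. *)
Lemma Lset_bounded T H x p : tree_of T H -> Lset T x p ->
  bounded (#|verts H|.-1 * Lmax I) p.
Proof.
move=> TH; elim: TH x p => [a a_neq|T1 T2 H1 H2 {}H _ IH1 _ IH2 [_ _ _ _ ->]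
  |T1 T2 H1 H2 {}H TH1 IH1 TH2 IH2 [_ cap _ ->]] x p.
- have la : maxn (len a).1 (len a).2 <= Lmax I.
    exact: (leq_bigmax (F := fun a : arc_of (graph I) => maxn (len a).1 (len a).2)).
  have bl : bounded (#|verts (single_arc a)|.-1 * Lmax I) (length_point a).
    rewrite /= cards2 a_neq mul1n; move: la; rewrite geq_max => /andP[? ?].
    by split=> v [<-].
  by rewrite /=; do 2?case: ifP => _; move=> ->.
- rewrite /= => -[[k _ [p1 /IH1 h1 [p2 /IH2 h2 <-]]] _].
  apply: bounded_pmin; [apply: bounded_le h1 | apply: bounded_le h2];
    rewrite leq_mul2r -!subn1 leq_sub2r ?orbT //;
    by rewrite subset_leq_card ?finset.subsetUl ?finset.subsetUr.
rewrite /= => -[[k _ [p1 /IH1 h1 [p2 /IH2 h2 <-]]] _].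
apply: bounded_le (bounded_padd h1 h2); rewrite -mulnDl leq_mul2r.
(* One shared vertex makes the numbers of vertices minus one add up; the truncated predecessors are
   exact since both operands are nonempty. *)
have := cardsUI (verts H1) (verts H2); rewrite cap cards1.
have := card_verts_gt1 TH1; have := card_verts_gt1 TH2; lia.
Qed.

Lemma entries_le_dp T H W : tree_of T H ->
  #|verts H|.-1 * Lmax I + 2 <= W ->
  entries_le W (root_table (result (dynamic_program T))).
Proof.
move=> TH KW; apply/(all_nthP [::]) => x xs.
have [sz h] := computes_all_root (dynamic_program_correct T).
rewrite (leq_trans _ KW) // addn2; apply: size_bounded; first exact: uniq_entries.
move=> p pin; apply: Lset_bounded TH _ => //; rewrite -h; first exact: pin.
by rewrite -ltnS -sz.
Qed.

(** * The running time over the whole tree *)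

(* The extra [node_cost] on the left accounts for a tree with k leaves having
   2k-1 nodes. *)
Lemma time_dynamic_program T H W j :
  tree_of T H -> #|verts H|.-1 * Lmax I + 2 <= W ->
  (budget I).+1 * W ^ 2 <= 2 ^ j ->
  time (dynamic_program T) + node_cost (budget I).+1 W j <=
  2 * #|arcs H| * node_cost (budget I).+1 W j.
Proof.
move=> TH HW; set b := _.+1 => bj; set c := node_cost _ _ _; move: HW.
(* Both compositions have disjoint arc sets, so the arc counts of the operands add up; one spare [c]
   from the two hypotheses pays for the new node. *)
have node o T1 T2 H1 H2 H' : tree_of T1 H1 -> tree_of T2 H2 ->
    arcs H1 :&: arcs H2 = finset.set0 ->
    arcs H' = arcs H1 :|: arcs H2 ->
    #|verts H1|.-1 * Lmax I + 2 <= W -> #|verts H2|.-1 * Lmax I + 2 <= W ->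
    time (dynamic_program T1) + c <= 2 * #|arcs H1| * c ->
    time (dynamic_program T2) + c <= 2 * #|arcs H2| * c ->
    time (dynamic_program (Node o T1 T2)) + c <= 2 * #|arcs H'| * c.
  move=> TH1 TH2 dis -> W1 W2 IH1 IH2.
  have := cardsUI (arcs H1) (arcs H2); rewrite dis cards0 addn0 => ->.
  rewrite dynamic_program_node time_step (time_bind (dynamic_program _)).
  rewrite (time_bind (dynamic_program _)) (time_bind (compose_tables _ _ _)) time_ret.
  have [sz1 _] := computes_all_root (dynamic_program_correct T2).
  have := @time_compose_from (composition_op o)
    (root_table (result (dynamic_program T1))) [::]
    (root_table (result (dynamic_program T2))) 2 W j b.
  have hop p q : time (composition_op o p q) <= 2 by rewrite time_composition_op.
  rewrite sz1 -/b -/(compose_tables _ _ _).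
  move=> /(_ hop (entries_le_dp TH1 W1) isT (entries_le_dp TH2 W2) (leqnn _) bj).
  move: IH1 IH2; rewrite /c /node_cost; move: (b * (_ + _)) => d; lia.
(* The bound [W] for a graph passes down to its operands, whose vertex sets are smaller. *)
have mono (V1 V2 : {set vertex (graph I)}) : V1 \subset V2 ->
    #|V2|.-1 * Lmax I + 2 <= W -> #|V1|.-1 * Lmax I + 2 <= W.
  move=> /subset_leq_card le12; apply: leq_trans.
  by rewrite leq_add2r leq_mul2r -!subn1 leq_sub2r ?orbT.
elim: TH => [a a_neq|T1 T2 H1 H2 H' TH1 IH1 TH2 IH2 [_ _ _ dis ->]
  |T1 T2 H1 H2 H' TH1 IH1 TH2 IH2 [_ _ dis ->]] HW.
- rewrite [arcs _]/= cards1 dynamic_program_leaf time_step (time_bind (succ_op _)).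
  rewrite (time_bind (leaf_table _ _ _)) (_ : time (succ_op _) = 1) // time_ret.
  rewrite -[result (succ_op _)]/b; have := time_leaf_table a 0 b.
  (* The summand [b * 5] of [node_cost] already covers the leaf table. *)
  have : 4 * b + 3 <= c.
    rewrite leq_add2r mulnC leq_mul2l; apply/orP; right.
    by rewrite (leq_trans _ (leq_addl _ 5)).
  move: (leaf_table _ _ _) => t; lia.
- by apply: node TH1 TH2 dis _ _ _ (IH1 _) (IH2 _) => //; apply: mono HW;
    rewrite ?finset.subsetUl ?finset.subsetUr.
by apply: node TH1 TH2 dis _ _ _ (IH1 _) (IH2 _) => //; apply: mono HW;
  rewrite ?finset.subsetUl ?finset.subsetUr.
Qed.
End Instance.

(** * Arithmetic of the final bound *)

(* With X = B n L, b W^2 <= 8 X^2 and X < 2^(l+1) <= 2^(2l) as l >= 1. *)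
Lemma node_cost_bound B n L b :
  0 < B -> 1 < n -> 0 < L -> b <= 2 * B ->
  let W := n * L + 1 in let l := trunc_log 2 (B * n * L) in
  b * W ^ 2 <= 2 ^ (7 * l) /\
  node_cost b W (7 * l) <= 721 * (B ^ 2 * (n * L) ^ 2 * l).
Proof.
move=> B0 n1 L0 bB W l; rewrite {}/W {}/l.
have M2 : 1 < n * L by rewrite (leq_trans n1) // leq_pmulr.
rewrite -mulnA; move: (n * L) M2 => M M2 {n n1 L L0}.
set X := B * M; have X2 : 1 < X by rewrite (leq_trans M2) // leq_pmull.
have l0 : 0 < trunc_log 2 X by rewrite trunc_log_gt0 X2.
have Xl : X < 2 ^ (trunc_log 2 X).+1 by exact: trunc_log_ltn.
move: (trunc_log 2 X) l0 Xl => l l0 Xl.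
have bW : b * (M + 1) ^ 2 <= 8 * (B * M ^ 2).
  apply: leq_trans (_ : (2 * B) * (2 * M) ^ 2 <= _); last by nia.
  by rewrite leq_mul // leq_exp2r //; lia.
have P1 : 0 < B * M ^ 2 by rewrite muln_gt0 B0 expn_gt0; lia.
have P2 : B * M ^ 2 <= X ^ 2 by rewrite expnMn leq_mul2r; apply/orP; right; nia.
split.
  have : X ^ 2 <= 2 ^ (2 * l.+1) by rewrite mulnC expnM leq_exp2r // ltnW.
  (* The exponent is [2 * l + 5], at most [7 * l] because [l] is positive; this is the origin of the
     [7 * l] sorting rounds. *)
  have : 8 * 2 ^ (2 * l.+1) <= 2 ^ (7 * l).
    by rewrite -[8]/(2 ^ 3) -expnD leq_pexp2l //; lia.
  lia.
have bw2 : b * ((M + 1) * (3 * (M + 1) + 2) + 2) <= 36 * (B * M ^ 2).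
  apply: leq_trans (_ : (2 * B) * (18 * M ^ 2) <= _); last by nia.
  by rewrite leq_mul //; nia.
rewrite /node_cost; move: (b * (_ * (3 * _ + 2) + 2)) (b * _ ^ 2) bW bw2 => a w wP aP.
have lP : B * M ^ 2 <= l * (B * M ^ 2) by rewrite leq_pmull.
(* 359 is 36 + 7 * 42 + 24 + 5, from [w <= 8 * (B * M ^ 2)] and [5 * w + 2 <= 42 * (B * M ^ 2)]. The
   factor [2 * B] then gives 718, and the final 3 of [node_cost] gives 721. *)
have inner : a + 7 * l * (5 * w + 2) + 3 * w + 5 <= 359 * (l * (B * M ^ 2)).
  have : l * (5 * w + 2) <= l * (42 * (B * M ^ 2)) by rewrite leq_mul2l; lia.
  lia.
have := leq_mul bB inner.
have -> : 2 * B * (359 * (l * (B * M ^ 2))) = 718 * (B * (l * (B * M ^ 2))) by lia.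
have : 0 < B * (l * (B * M ^ 2)) by rewrite !muln_gt0 B0 l0; lia.
have -> : B ^ 2 * M ^ 2 * l = B * (l * (B * M ^ 2)) by lia.
move: (B * (l * _)) (b * _); lia.
Qed.

(* The time bound is required of all instances: B and Lmax are replaced by
   max(B,1) and max(Lmax,1), since the formula vanishes for B = 0 or Lmax = 0;
   the logarithm is the integer part of the binary logarithm. *)
Theorem theorem4 :
  (forall (I : instance) (T : tree (arc_of (graph I))),
     decomposition_tree T ->
     computes_all T (result (dynamic_program T)))
  /\
  (exists C : nat, forall (I : instance) (T : tree (arc_of (graph I))),
     decomposition_tree T ->
     let n := #|vertex (graph I)| in
     let m := #|arc_of (graph I)| in
     let B := maxn (budget I) 1 in
     let L := maxn (Lmax I) 1 in
     time (dynamic_program T) <=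
       C * (m * B ^ 2 * n ^ 2 * L ^ 2 * trunc_log 2 (B * n * L))).
Proof.
split=> [I T _|]; first exact: dynamic_program_correct.
(* 1442 is 2 * 721: fewer than [2 * m] nodes, each within the bound of [node_cost_bound]. *)
exists 1442 => I T TG; cbv zeta.
set n := #|vertex _|; set m := #|arc_of _|; set B := maxn (budget I) 1.
set L := maxn (Lmax I) 1.
have n1 : 1 < n by have := card_verts_gt1 TG; rewrite cardsT.
have [] := @node_cost_bound B n L (budget I).+1 _ n1.
- by rewrite leq_maxr.
- by rewrite leq_maxr.
- by rewrite /B; lia.
set W := _ + 1; set l := trunc_log _ _ => bj cost.
(* As [L] is at least 1, [n.-1 * L + 2] is at most [n * L + 1]; the maximum with 1 in [L] matters
   here. *)
have HW : #|verts (whole (graph I))|.-1 * Lmax I + 2 <= W.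
  have le : #|verts (whole (graph I))|.-1 * Lmax I <= n.-1 * L.
    by rewrite cardsT leq_mul2l leq_maxl orbT.
  have : n * L = n.-1 * L + L by rewrite -[in LHS](prednK (ltnW n1)) mulSn addnC.
  have : 0 < L by rewrite leq_maxr.
  rewrite /W; lia.
have := time_dynamic_program TG HW bj.
rewrite [arcs _]/= cardsT -/m => /(leq_trans (leq_addr _ _)) /leq_trans; apply.
apply: leq_trans (leq_mul (leqnn _) cost) _.
by rewrite expnMn; lia.
Qed.
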